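(* Let $2\le t\le n-1$, and put $T=3^t$, $T'=3^{t-1}$, $M=3^{n-t}$, $M'=3^{n-t+1}$. The number $nr'_=(n,t)$ of isomorphism classes of Steiner triple systems on $3^n$ points with $3$-rank exactly $3^n-n-1+t$ satisfies $$nr'_=(n,t)\ge \frac{N_1(T)^M\cdot N_3(T)^{M(M-1)/6}}{(T!)^M\cdot|AGL(n-t,3)|}-\frac{N_1(T')^{M'}\cdot N_3(T')^{M'(M'-1)/6}}{((T')!)^{M'-n+t-2}}.$$
   Context: The $3$-rank of a Steiner triple system is the rank over $\mathrm{GF}(3)$ of its block-by-point incidence matrix. $N_1(v)$ is the number of distinct Steiner triple systems on a fixed labeled $v$-set. $N_3(g)$ is the number of distinct transversal designs $TD[3;g]$ on three fixed pairwise disjoint groups of size $g$, i.e. sets of $3$-subsets each meeting every group in exactly one point such that any two points from different groups lie in exactly one of these $3$-subsets. $AGL(m,3)$ is the affine group of $\mathrm{GF}(3)^m$, of order $3^m\prod_{i=0}^{m-1}(3^m-3^i)$. *)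

(* Defs.v *)
From HB Require Import structures.
From mathcomp Require Import all_boot all_order all_fingroup all_algebra.

Set Implicit Arguments.
Unset Strict Implicit.
Unset Printing Implicit Defensive.

Import Order.TTheory GRing.Theory Num.Theory.

Definition is_STS (V : finType) (B : {set {set V}}) : bool :=
  [forall b in B, #|b| == 3] &&
  [forall x : V, forall y : V,
     (x != y) ==> (#|[set b in B | (x \in b) && (y \in b)]| == 1)].

Definition rank3 (v : nat) (B : {set {set 'I_v}}) : nat :=
  \rank (\matrix_(i < #|B|, j < v) ((j \in enum_val i)%:R : 'F_3))%R.

Definition iso_STS (V : finType) : rel {set {set V}} :=
  fun B B' => [exists s : {perm V}, B' == [set s @: (b : {set V}) | b in B]].

Lemma iso_STS_equiv (V : finType) : equivalence_rel (@iso_STS V).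
Proof.
have im1 (B : {set {set V}}) :
    [set (1%g : {perm V}) @: (b : {set V}) | b in B] = B.
  rewrite -[RHS]imset_id; apply: eq_imset => b.
  by rewrite -[RHS]imset_id; apply: eq_imset => x; rewrite perm1.
have imM (s u : {perm V}) (B : {set {set V}}) :
    [set (s * u)%g @: (b : {set V}) | b in B] =
    [set u @: (b : {set V}) | b in [set s @: (b : {set V}) | b in B]].
  rewrite -imset_comp; apply: eq_imset => b /=.
  by rewrite -imset_comp; apply: eq_imset => x; rewrite /= permM.
move=> B C D; split; first by apply/existsP; exists 1%g; rewrite im1.
case/existsP=> s /eqP ->; apply/existsP/existsP => -[u /eqP ->].
  by exists (s^-1 * u)%g; rewrite -imM mulgA mulgV mul1g.
by exists (s * u)%g; rewrite imM.
Qed.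

Definition N1 (v : nat) : nat := #|[set B : {set {set 'I_v}} | is_STS B]|.

(* The three groups of size g are the fibres of the first projection. *)
Definition is_TD3 (g : nat) (B : {set {set 'I_3 * 'I_g}}) : bool :=
  [forall b in B, (#|b| == 3) &&
     [forall i : 'I_3, #|[set p in b | p.1 == i]| == 1]] &&
  [forall p : 'I_3 * 'I_g, forall q : 'I_3 * 'I_g,
     (p.1 != q.1) ==> (#|[set b in B | (p \in b) && (q \in b)]| == 1)].

Definition N3 (g : nat) : nat :=
  #|[set B : {set {set 'I_3 * 'I_g}} | is_TD3 B]|.

Definition AGL3 (m : nat) : {set {perm 'rV['F_3]_m}} :=
  [set s : {perm 'rV['F_3]_m} |
     [exists A : 'M['F_3]_m, exists b : 'rV['F_3]_m,
        (A \in unitmx) && [forall x, s x == x *m A + b]]]%R.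

(* The truncated subtractions are exact, since n + 1 <= 3 ^ n. *)
Definition nr_eq (n t : nat) : nat :=
  #|equivalence_partition (@iso_STS 'I_(3 ^ n))
      [set B : {set {set 'I_(3 ^ n)}} |
         is_STS B && (rank3 B == 3 ^ n - n - 1 + t)]|.

(* Main.v *)
(* Fix a map f from the points to GF(3)^m, m = n - t, with fibres of size 3^t.
   A Steiner triple system on which f sums to zero over every block has each block
   either inside a fibre or transversal to three fibres over a line, and these
   pieces can be chosen independently: a system on each fibre, a transversal design
   over each line. This counts the systems orthogonal to f, whose 3-rank is at most
   3^n - m - 1. If the rank is smaller, some h orthogonal to all blocks does not
   factor through f; then (f, h) again has equal fibres, so the same count bounds
   the systems orthogonal to (f, h), and comparing stabilisers bounds the number of
   such h. When the rank is exact, 1 and f span the orthogonal space, so an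
   isomorphism between two such systems induces an affine map of GF(3)^m, and an
   isomorphism class contains at most T!^M |AGL(m, 3)| of the systems. *)
Require Import Defs.
From HB Require Import structures.
From mathcomp Require Import all_boot all_order all_fingroup all_algebra zify.

Set Implicit Arguments.
Unset Strict Implicit.
Unset Printing Implicit Defensive.

Import Order.TTheory GRing.Theory Num.Theory.

(* Provides the missing [finZmodType] instance on products. *)
HB.saturate prod.

(** * Maps with fibres of equal size *)

Definition balanced (V A : finType) (f : V -> A) (w : nat) : bool :=
  [forall a, #|[set x | f x == a]| == w].

Lemma balanced_card (V A : finType) (f : V -> A) w :
  balanced f w -> #|V| = #|A| * w.
Proof.
move=> /forallP bal; rewrite -sum1_card (partition_big f xpredT) //=.
rewrite -sum_nat_const; apply: eq_bigr => a _.
by rewrite sum1dep_card (eqP (bal a)).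
Qed.

(** Enumerating every fibre by ['I_w] gives coordinates on [V] in which [f] is the first
    projection. *)
Lemma balanced_chart (V A : finType) (f : V -> A) w : balanced f w ->
  exists2 phi : A * 'I_w -> V, bijective phi & forall p, f (phi p) = p.1.
Proof.
move=> bal; have card_fib a : w = #|[set x | f x == a]|.
  by have /eqP-> := forallP bal a.
pose phi (p : A * 'I_w) := enum_val (cast_ord (card_fib p.1) p.2).
have fphi p : f (phi p) = p.1.
  by have := enum_valP (cast_ord (card_fib p.1) p.2); rewrite inE => /eqP.
exists phi => //; apply: inj_card_bij; last first.
  by rewrite (balanced_card bal) card_prod card_ord.
move=> [a i] [b j] eq_phi; have eq_ab : a = b by have := fphi (a, i); rewrite eq_phi fphi.
by case: _ / eq_ab j eq_phi => j /enum_val_inj /cast_ord_inj /= ->.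
Qed.

(** In a chart, a permutation preserving [f] is the same as one permutation of ['I_w] for each point
    of [A]. *)
Lemma card_fibre_perms (V A : finType) (f : V -> A) w : balanced f w ->
  #|[set s : {perm V} | [forall x, f (s x) == f x]]| = w`! ^ #|A|.
Proof.
move=> /balanced_chart [phi [psi phiK psiK] fphi].
have psi1 x : (psi x).1 = f x by rewrite -fphi psiK.
pose F (sg : {ffun A -> {perm 'I_w}}) x := phi ((psi x).1, sg (psi x).1 (psi x).2).
have F_inj sg : injective (F sg).
  move=> x y /(can_inj phiK) [e1]; rewrite e1 => /perm_inj e2.
  apply: (can_inj psiK); move: e1 e2.
  by case: (psi x) (psi y) => [a i] [b j] /= -> ->.
have inj_perm : injective (fun sg => perm (@F_inj sg)).
  move=> sg tau /permP eq_st; apply/ffunP => a; apply/permP => i.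
  by have := eq_st (phi (a, i)); rewrite !permE /F phiK => /(can_inj phiK) [].
rewrite -card_Sn -card_ffun -(card_imset _ inj_perm); apply: eq_card => s.
rewrite inE; apply/forallP/imsetP => [fs | [sg _ ->] x]; last first.
  by rewrite permE /F fphi psi1.
have G_inj a : injective (fun i => (psi (s (phi (a, i)))).2).
  move=> i j eq_ij; have [] // : (a, i) = (a, j).
  apply: (can_inj phiK); apply: (@perm_inj _ s); apply: (can_inj psiK).
  apply: injective_projections => //.
  by rewrite !psi1 (eqP (fs _)) (eqP (fs _)) !fphi.
exists [ffun a => perm (@G_inj a)] => //; apply/permP => x.
rewrite permE /F ffunE permE -surjective_pairing psiK psi1 -(eqP (fs x)) -psi1.
by rewrite -surjective_pairing psiK.
Qed.

(** The inverse of a chart for [f], followed by a chart for [g], is the required permutation. *)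
Lemma balanced_conj (V A : finType) (f g : V -> A) w :
  balanced f w -> balanced g w -> exists s : {perm V}, forall x, g (s x) = f x.
Proof.
move=> /balanced_chart [phi [psi phiK psiK] fphi] /balanced_chart [chi chi_bij gchi].
have inj_s : injective (chi \o psi).
  by move=> x y /(bij_inj chi_bij) /(can_inj psiK).
by exists (perm inj_s) => x; rewrite permE /= gchi -fphi psiK.
Qed.

(** * Decomposition of the systems annihilated by f *)

Definition zero_sum (V : finType) (A : zmodType) (f : V -> A) (b : {set V}) : bool :=
  (\sum_(x in b) f x == 0)%R.

Definition annihilates (V : finType) (A : zmodType) (f : V -> A)
    (B : {set {set V}}) : bool :=
  [forall b in B, zero_sum f b].

Definition through (V : finType) (B : {set {set V}}) (x y : V) : {set {set V}} :=
  [set b in B | (x \in b) && (y \in b)].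

Lemma is_STSP (V : finType) (B : {set {set V}}) :
  reflect ((forall b, b \in B -> #|b| = 3) /\
           (forall x y, x != y -> #|through B x y| = 1)) (is_STS B).
Proof.
apply: (iffP andP) => [[/forall_inP B3 /forallP B1] | [B3 B1]]; split.
- by move=> b /B3 /eqP.
- by move=> x y nxy; move/forallP/(_ y)/implyP/(_ nxy)/eqP: (B1 x).
- by apply/forall_inP => b /B3 ->.
- by apply/forallP => x; apply/forallP => y; apply/implyP => nxy; rewrite -/(through B x y) B1.
Qed.

Lemma through_inj (V : finType) (B : {set {set V}}) x y b b' :
  is_STS B -> x != y -> b \in B -> b' \in B ->
  x \in b -> y \in b -> x \in b' -> y \in b' -> b = b'.
Proof.
case/is_STSP=> _ B1 nxy bB b'B xb yb xb' yb'.
have /eqP/cards1P [c defc] := B1 _ _ nxy.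
have: b \in through B x y by rewrite inE bB xb yb.
have: b' \in through B x y by rewrite inE b'B xb' yb'.
by rewrite defc !inE => /eqP-> /eqP->.
Qed.

Lemma card3_third (V : finType) (b : {set V}) x y :
  #|b| = 3 -> x \in b -> y \in b -> x != y ->
  exists z, [/\ z != x, z != y & b = [set x; y; z]].
Proof.
move=> b3 xb yb nxy.
have /cards1P [z defz] : #|b :\ x :\ y| == 1.
  have := cardsD1 x b; have := cardsD1 y (b :\ x).
  by rewrite xb b3 !inE eq_sym nxy yb !add1n => -> [<-].
have: z \in b :\ x :\ y by rewrite defz inE.
rewrite !inE => /and3P [nzy nzx zb]; exists z; split=> //.
apply/setP => u; move/setP/(_ u): defz; rewrite !inE.
by case: eqVneq => [->|_]; case: eqVneq => [->|_] //=; rewrite ?xb ?yb.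
Qed.

Lemma exists_block (V : finType) (B : {set {set V}}) x y :
  is_STS B -> x != y -> exists z, [/\ z != x, z != y & [set x; y; z] \in B].
Proof.
case/is_STSP=> B3 B1 nxy.
have /eqP/cards1P [b defb] := B1 _ _ nxy.
have: b \in through B x y by rewrite defb inE.
rewrite inE => /and3P [bB xb yb].
by have [z [zx zy defb']] := card3_third (B3 _ bB) xb yb nxy; exists z; rewrite -defb'.
Qed.

Lemma big_set3 (V : finType) (A : zmodType) (f : V -> A) x y z :
  x != y -> z != x -> z != y -> (\sum_(u in [set x; y; z]) f u = f x + f y + f z)%R.
Proof.
move=> nxy nzx nzy; rewrite setUC big_setU1; last by rewrite !inE negb_or nzx.
by rewrite big_setU1 ?big_set1 ?inE // addrC.
Qed.

(** In a group of exponent 3 this is the affine line through [a] and [b], or the single point [a]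
    when [a = b]. *)
Definition cell (A : finZmodType) (a b : A) : {set A} := [set a; b; (- (a + b))%R].

Lemma cellC (A : finZmodType) (a b : A) : cell a b = cell b a.
Proof. by rewrite /cell addrC [X in X :|: _]setUC. Qed.

Lemma cell_third (A : finZmodType) (a b : A) : cell a (- (a + b))%R = cell a b.
Proof. by rewrite /cell opprD addrA subrr add0r opprK setUAC. Qed.

(** The zero sum forces the third value, so two points of a block already determine its image. This
    is what allows blocks to be sorted by image. *)
Lemma zero_sum_cell (V : finType) (A : finZmodType) (f : V -> A) (b : {set V}) x y :
  #|b| = 3 -> zero_sum f b -> x \in b -> y \in b -> x != y ->
  f @: b = cell (f x) (f y).
Proof.
move=> b3 /eqP fb0 xb yb nxy; have [z [zx zy defb]] := card3_third b3 xb yb nxy.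
move: fb0; rewrite defb big_set3 // => /eqP; rewrite addrC addr_eq0 => /eqP fz.
by rewrite !imsetU !imset_set1 fz.
Qed.

(* The systems annihilated by f decompose into independent local pieces, one for
   each possible image c of a block. *)
Definition local_piece (V : finType) (A : finZmodType) (f : V -> A) (c : {set A})
    : {set {set {set V}}} :=
  [set X : {set {set V}} |
     [forall b in X, [&& #|b| == 3, zero_sum f b & f @: b == c]] &&
     [forall x, forall y, (x != y) && (cell (f x) (f y) == c)
        ==> (#|through X x y| == 1)]].

Lemma local_pieceP (V : finType) (A : finZmodType) (f : V -> A) c (X : {set {set V}}) :
  reflect ((forall b, b \in X -> [/\ #|b| = 3, zero_sum f b & f @: b = c]) /\
           (forall x y, x != y -> cell (f x) (f y) = c -> #|through X x y| = 1))
    (X \in local_piece f c).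
Proof.
rewrite inE; apply: (iffP andP) => [[/forall_inP X3 /forallP X1] | [X3 X1]]; split.
- by move=> b /X3 /and3P [/eqP ? ? /eqP ?].
- by move=> x y nxy cxy; apply/eqP; move/forallP/(_ y)/implyP: (X1 x); apply; rewrite nxy cxy eqxx.
- by apply/forall_inP => b /X3 [-> -> ->]; rewrite !eqxx.
- apply/forallP => x; apply/forallP => y; apply/implyP => /andP [nxy /eqP cxy].
  by rewrite X1.
Qed.

(** Sorting the blocks by their image splits a system into pieces. The condition on a pair x, y
    involves only the piece over [cell (f x) (f y)], so the pieces vary independently and the counts
    multiply. *)
Lemma card_STS_annihilated (V : finType) (A : finZmodType) (f : V -> A) :
  #|[set B : {set {set V}} | is_STS B && annihilates f B]|
  = \prod_(c : {set A}) #|local_piece f c|.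
Proof.
pose pieces (B : {set {set V}}) := [ffun c : {set A} => [set b in B | f @: b == c]].
have pieces_inj : injective pieces.
  move=> B B' /ffunP eqBB'; apply/setP => b.
  by have /setP/(_ b) := eqBB' (f @: b); rewrite !ffunE !inE eqxx !andbT.
transitivity #|family (fun c => mem (local_piece f c))|; last first.
  by rewrite card_family foldrE big_map -big_enum /=; apply: congr_big.
rewrite -(card_imset _ pieces_inj); apply: eq_card => G.
apply/imsetP/familyP => [[B + ->] c | Gloc].
  rewrite inE => /andP [stsB /forall_inP fB]; have [B3 B1] := is_STSP _ stsB.
  rewrite ffunE; apply/local_pieceP; split=> [b | x y nxy cxy].
    by rewrite inE => /andP [bB /eqP ->]; rewrite B3 ?fB.
  rewrite -(B1 x y nxy); apply: eq_card => b; rewrite !inE.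
  case bB: (b \in B) => //=; case xb: (x \in b); rewrite ?andbF //=.
  case yb: (y \in b); rewrite ?andbF //=.
  by rewrite (zero_sum_cell (B3 _ bB) (fB _ bB) xb yb nxy) cxy eqxx.
have {}Gloc c := local_pieceP _ _ _ (Gloc c).
(* The union of the pieces: a block can only belong to the piece indexed by its own image. *)
exists [set b : {set V} | b \in G (f @: b)]; last first.
  apply/ffunP => c; rewrite ffunE; apply/setP => b; rewrite !inE.
  apply/idP/andP => [bG | [+ /eqP <-] //].
  by have [/(_ _ bG) [_ _ ->] _] := Gloc c; rewrite eqxx.
have G3 (b : {set V}) : b \in G (f @: b) -> #|b| = 3 /\ zero_sum f b.
  by move=> bG; have [/(_ _ bG) []] := Gloc (f @: b).
rewrite inE; apply/andP; split; last by apply/forall_inP => b; rewrite inE => /G3 [].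
apply/is_STSP; split=> [b | x y nxy]; first by rewrite inE => /G3 [].
have [G3' /(_ x y nxy (erefl _)) <-] := Gloc (cell (f x) (f y)).
apply: eq_card => b; rewrite !inE.
case xb: (x \in b); rewrite ?andbF //=; case yb: (y \in b); rewrite ?andbF //= !andbT.
apply/idP/idP => bG.
  by have [b3 fb0] := G3 _ bG; rewrite -(zero_sum_cell b3 fb0 xb yb nxy).
by have [_ _ ->] := G3' _ bG.
Qed.

Lemma opp_double (C : zmodType) (c : C) : (c *+ 3 = 0 -> - (c + c) = c)%R.
Proof. by move=> c3; apply/esym/eqP; rewrite -addr_eq0 -mulr2n -mulrS c3. Qed.

(** * Transport of block systems along an injection *)

Definition lift_system (U V : finType) (g : U -> V) (X : {set {set U}}) : {set {set V}} :=
  [set g @: (b : {set U}) | b in X].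

Lemma card_through_lift (U V : finType) (g : U -> V) (X : {set {set U}}) x y :
  injective g -> #|through (lift_system g X) (g x) (g y)| = #|through X x y|.
Proof.
move=> g_inj; rewrite -[RHS](card_imset _ (imset_inj g_inj)).
apply: eq_card => b; rewrite inE; apply/andP/imsetP => [[/imsetP [c cX ->]] | [c + ->]].
  by rewrite !mem_imset // => xyc; exists c; rewrite // inE cX.
by rewrite inE => /andP [cX xyc]; rewrite !(mem_imset _ _ g_inj); split=> //; apply: imset_f.
Qed.

(** The last hypothesis keeps all blocks of members of [S'] inside the image of [g]. Taking
    preimages then inverts the lifting. *)
Lemma card_transport (U V : finType) (g : U -> V)
    (S : {set {set {set U}}}) (S' : {set {set {set V}}}) :
  injective g ->
  (forall X, (lift_system g X \in S') = (X \in S)) ->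
  (forall X b y, X \in S' -> b \in X -> y \in b -> y \in codom g) ->
  #|S'| = #|S|.
Proof.
move=> g_inj SS' rangeS'.
have lift_inj : injective (lift_system g) by apply/imset_inj/imset_inj.
rewrite -(card_imset _ lift_inj); apply: eq_card => X'.
apply/idP/imsetP => [X'S' | [X XS ->]]; last by rewrite SS'.
have preimK b : b \in X' -> g @: (g @^-1: b) = b.
  move=> bX'; apply/setP => y; apply/imsetP/idP => [[x + ->] | yb]; first by rewrite inE.
  have /codomP [x defy] := rangeS' _ _ _ X'S' bX' yb.
  by exists x; rewrite // inE -defy.
have defX' : X' = lift_system g [set b | g @: (b : {set U}) \in X'].
  apply/setP => b; apply/idP/imsetP => [bX' | [c + ->]]; last by rewrite inE.
  by exists (g @^-1: b); rewrite ?inE preimK.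
by exists [set b | g @: (b : {set U}) \in X']; rewrite // -SS' -defX'.
Qed.

Lemma is_TD3P g (B : {set {set 'I_3 * 'I_g}}) :
  reflect ((forall b, b \in B -> #|b| = 3 /\ fst @: b = [set: 'I_3]) /\
           (forall p q, p.1 != q.1 -> #|through B p q| = 1)) (is_TD3 B).
Proof.
(* For a set of three points, meeting each of the three groups once amounts to projecting onto all
   groups. *)
have transversal (b : {set 'I_3 * 'I_g}) : #|b| = 3 ->
    [forall i : 'I_3, #|[set p in b | p.1 == i]| == 1] = (fst @: b == [set: 'I_3]).
  move=> b3; apply/forallP/eqP => [b1 | fb i].
    apply/setP => i; rewrite [RHS]inE.
    have /cards1P [p defp] := b1 i; have: p \in [set p in b | p.1 == i] by rewrite defp inE.
    by rewrite inE => /andP [pb /eqP <-]; rewrite imset_f.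
  have /imset_injP fst_inj : #|fst @: b| == #|b| by rewrite fb b3 cardsT card_ord.
  have: i \in fst @: b by rewrite fb inE.
  case/imsetP=> p pb defi; apply/cards1P; exists p; apply/setP => q.
  rewrite !inE defi; apply/andP/eqP => [[qb /eqP eqpq] | ->] //.
  exact: fst_inj.
apply: (iffP andP) => [[/forall_inP B3 /forallP B1] | [B3 B1]]; split.
- move=> b bB; have /andP [/eqP b3 bi] := B3 b bB; split=> //.
  by apply/eqP; rewrite -transversal.
- by move=> p q npq; move/forallP/(_ q)/implyP/(_ npq)/eqP: (B1 p).
- by apply/forall_inP => b /B3 [b3 bi]; rewrite transversal // b3 bi !eqxx.
- apply/forallP => p; apply/forallP => q; apply/implyP => npq.
  by rewrite -/(through B p q) B1.
Qed.

(** * Counting the local pieces over points and lines *)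

Section Pieces.

Variables (V : finType) (A : finZmodType) (f : V -> A) (w : nat).
Hypothesis A3 : forall a : A, (a *+ 3 = 0)%R.
Hypothesis f_bal : balanced f w.

Lemma cell_id (a : A) : cell a a = [set a].
Proof. by rewrite /cell opp_double // !setUid. Qed.

(** If the third point were [a], the cell would collapse to [cell a a], the singleton of [a], yet it
    contains [b]. *)
Lemma third_neq (a b : A) : a != b -> (- (a + b) != a)%R.
Proof.
apply: contraNneq => eq_a.
have /setP/(_ b) := cell_third a b; rewrite eq_a cell_id !inE eqxx orbT /= eq_sym.
by move->.
Qed.

Lemma card_cell (a b : A) : a != b -> #|cell a b| = 3.
Proof.
move=> nab; rewrite /cell setUC cardsU1 cards2 nab !inE negb_or third_neq //.
by rewrite addrC third_neq // eq_sym.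
Qed.

Lemma cell_eq (a b c d : A) :
  c \in cell a b -> d \in cell a b -> c != d -> cell c d = cell a b.
Proof.
have third_l : cell (- (a + b))%R a = cell a b by rewrite cellC cell_third.
have third_b : cell b (- (a + b))%R = cell a b by rewrite addrC cell_third cellC.
rewrite !inE -!orbA => /or3P [] /eqP -> /or3P [] /eqP ->; rewrite ?eqxx // => _.
- exact: cell_third.
- exact: cellC.
- by rewrite cellC.
Qed.

(** Inside one fibre the zero-sum condition is automatic, since three times [a] is 0. A piece is
    therefore any triple system on the [w] points of the fibre. *)
Lemma card_piece_point (a : A) : #|local_piece f [set a]| = N1 w.
Proof.
have [phi phi_bij fphi] := balanced_chart f_bal.
have phi_inj := bij_inj phi_bij.
pose g i := phi (a, i).
have g_inj : injective g by move=> i j /phi_inj [].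
have fg i : f (g i) = a by rewrite fphi.
have range_g x : f x = a -> exists i, x = g i.
  have [psi _ psiK] := phi_bij; move=> fx; exists (psi x).2.
  by rewrite /g -fx -[in f x](psiK x) fphi -surjective_pairing psiK.
apply: (card_transport g_inj) => [X | X b y /local_pieceP [X3 _] /X3 [_ _ fb] yb]; last first.
  have [i ->] : exists i, y = g i; last exact: codom_f.
  by apply: range_g; apply/set1P; rewrite -fb imset_f.
rewrite [RHS]inE; apply/local_pieceP/is_STSP => -[X3 X1]; split.
- move=> b bX; have [] := X3 (g @: b); first exact: imset_f.
  by rewrite card_imset.
- move=> i j nij; rewrite -(card_through_lift X i j g_inj) X1 ?(inj_eq g_inj) //.
  by rewrite !fg cell_id.
- move=> _ /imsetP [b bX ->]; have b3 := X3 b bX.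
  rewrite card_imset // b3; split=> //.
    rewrite /zero_sum big_imset /=; last exact: in2W.
    by rewrite (eq_bigr (fun=> a)) // sumr_const b3 A3.
  rewrite -imset_comp (eq_imset (g := fun=> a)) //.
  have [i ib] : exists i, i \in b by apply/card_gt0P; rewrite b3.
  by apply/setP => c; rewrite inE; apply/imsetP/eqP => [[]// | ->]; exists i.
move=> x y nxy cxy.
have [i defx] : exists i, x = g i by apply: range_g; apply/set1P; rewrite -cxy !inE eqxx.
have [j defy] : exists j, y = g j by apply: range_g; apply/set1P; rewrite -cxy !inE eqxx orbT.
by rewrite defx defy card_through_lift // X1 // -(inj_eq g_inj) -defx -defy.
Qed.

(** The i-th group of a transversal design is placed on the fibre over the i-th point [l i] of the
    line. A transversal block then has sum zero because the three points of a line sum to zero. *)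
Lemma card_piece_line (a b : A) : a != b -> #|local_piece f (cell a b)| = N3 w.
Proof.
move=> nab; have [phi phi_bij fphi] := balanced_chart f_bal.
have phi_inj := bij_inj phi_bij.
pose l (i : 'I_3) := tnth [tuple a; b; (- (a + b))%R] i.
have l_inj : injective l.
  apply/tuple_uniqP; rewrite /= !inE !negb_or nab (eq_sym a) (eq_sym b) third_neq //=.
  by rewrite addrC third_neq // eq_sym.
have im_l : l @: [set: 'I_3] = cell a b.
  apply/setP => x; rewrite !inE -orbA; apply/imsetP/or3P => [[i _ ->] | ].
    by case: i => [[|[|[|//]]] ?]; [apply: Or31|apply: Or32|apply: Or33]; rewrite /l (tnth_nth a) /=.
  by case=> /eqP ->; [exists ord0 | exists (inord 1) | exists (inord 2)] => //;
    rewrite /l (tnth_nth a) /= ?inordK.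
have sum_l : (\sum_i l i = 0)%R.
  by rewrite !big_ord_recl big_ord0 /l !(tnth_nth a) /= addr0 addrA addrN.
have cell_l i j : i != j -> cell (l i) (l j) = cell a b.
  by move=> nij; apply: cell_eq; rewrite ?(inj_eq l_inj) // -im_l imset_f.
pose g (p : 'I_3 * 'I_w) := phi (l p.1, p.2).
have g_inj : injective g by move=> [i j] [i' j'] /phi_inj [/l_inj -> ->].
have fg p : f (g p) = l p.1 by rewrite fphi.
have range_g x : f x \in cell a b -> exists p, x = g p.
  rewrite -im_l => /imsetP [i _ fx]; have [psi _ psiK] := phi_bij.
  exists (i, (psi x).2).
  by rewrite /g -fx -[in f x](psiK x) fphi -surjective_pairing psiK.
have fg_im (c : {set 'I_3 * 'I_w}) : f @: (g @: c) = l @: (fst @: c).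
  by rewrite -!imset_comp; apply: eq_imset => p /=.
apply: (card_transport g_inj) => [X | X c y /local_pieceP [X3 _] /X3 [_ _ fc] yc]; last first.
  have [p ->] : exists p, y = g p; last exact: codom_f.
  by apply: range_g; rewrite -fc imset_f.
rewrite [RHS]inE; apply/local_pieceP/is_TD3P => -[X3 X1]; split.
- move=> c cX; have [] := X3 (g @: c); first exact: imset_f.
  rewrite card_imset // fg_im -im_l => -> _ eq_l; split=> //.
  exact: (imset_inj l_inj).
- move=> p q npq; rewrite -(card_through_lift X p q g_inj) X1 ?fg ?cell_l //.
  by apply: contraNneq npq => /g_inj ->.
- move=> _ /imsetP [c cX ->]; have [c3 c1] := X3 c cX.
  rewrite card_imset // fg_im c1 im_l; split=> //.
  have /imset_injP fst_inj : #|fst @: c| == #|c| by rewrite c1 c3 cardsT card_ord.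
  rewrite /zero_sum big_imset /=; last exact: in2W.
  rewrite (eq_bigr (l \o fst)); last by move=> p _; rewrite fg.
  rewrite -(big_imset l) //= c1.
  by rewrite (eq_bigl xpredT) ?sum_l // => i; rewrite inE.
move=> x y nxy cxy.
have nfxy : f x != f y.
  by apply/eqP => eqf; have := card_cell nab; rewrite -cxy eqf cell_id cards1.
have [p defx] : exists p, x = g p by apply: range_g; rewrite -cxy !inE eqxx.
have [q defy] : exists q, y = g q by apply: range_g; rewrite -cxy !inE eqxx orbT.
rewrite defx defy card_through_lift // X1 //.
by apply: contraNneq nfxy => eqpq; rewrite defx defy !fg eqpq.
Qed.

Definition lines : {set {set A}} :=
  [set cell p.1 p.2 | p in [set p : A * A | p.1 != p.2]].

(** Double counting of ordered pairs of distinct points: each pair spans one line, and each line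
    contains 3 * 2 such pairs. *)
Lemma card_lines : 6 * #|lines| = #|A| * (#|A| - 1).
Proof.
have offdiag (c : {set A}) : #|[set p in setX c c | p.1 != p.2]| = #|c| * (#|c| - 1).
  have <- : #|setX c c :\: [set (x, x) | x in c]| = #|c| * (#|c| - 1).
    rewrite cardsD cardsX (setIidPr _); last first.
      by apply/subsetP => _ /imsetP [x xc ->]; rewrite inE xc.
    by rewrite card_imset ?mulnBr ?muln1 // => x y [].
  apply: eq_card => -[x y]; rewrite !inE /=.
  case: (boolP (x \in c)) => xc; rewrite ?andbF //= [LHS]andbC; congr (~~ _ && _).
  by apply/eqP/imsetP => [<- | [u _ [-> ->]] //]; exists x.
have <- : #|[set p : A * A | p.1 != p.2]| = #|A| * (#|A| - 1).
  by rewrite -cardsT -offdiag; apply: eq_card => p; rewrite !inE.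
rewrite -[RHS]sum1_card (partition_big_imset (fun p => cell p.1 p.2)) /=.
rewrite mulnC -sum_nat_const; apply: eq_bigr => _ /imsetP [[a b] nab ->].
rewrite inE /= in nab.
rewrite sum1dep_card -[6]/(3 * (3 - 1)) -(card_cell nab) -offdiag.
apply: eq_card => -[c d]; rewrite !inE /=; case: (eqVneq c d) => /= ncd; rewrite ?andbF ?andbT //.
apply/andP/eqP => [[cab dab] | /setP eqc]; first by apply: cell_eq; rewrite // !inE.
by have := eqc c; have := eqc d; rewrite !inE !eqxx !orbT => <- <-.
Qed.

(** The image of a block is a cell, hence a point or a line. Over any other [c] only the empty piece
    remains, which contributes a factor 1. *)
Lemma card_piece_empty (c : {set A}) :
  c \notin lines -> (forall a, c != [set a]) -> #|local_piece f c| = 1.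
Proof.
move=> nlc npc.
have ncell x y : cell (f x) (f y) <> c.
  move=> cxy; case: (eqVneq (f x) (f y)) => [eqf | neqf].
    by have := npc (f x); rewrite -cxy eqf cell_id eqxx.
  case/negP: nlc; apply/imsetP; exists (f x, f y) => //=.
  by rewrite inE.
apply/eqP/cards1P; exists set0; apply/setP => X; rewrite [RHS]inE.
apply/local_pieceP/eqP => [[X3 _] | ->]; last first.
  by split=> [b | x y _ /ncell]; first by rewrite inE.
apply/setP => b; rewrite inE; apply/negP => /X3 [b3 fb0 fbc].
have /card_gt1P [x [y [xb yb nxy]]] : 1 < #|b| by rewrite b3.
by apply: (ncell x y); rewrite -fbc (zero_sum_cell b3 fb0 xb yb nxy).
Qed.

Lemma card_STS_annihilated_balanced :
  #|[set B : {set {set V}} | is_STS B && annihilates f B]|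
  = N1 w ^ #|A| * N3 w ^ (#|A| * (#|A| - 1) %/ 6).
Proof.
pose points : {set {set A}} := [set [set a] | a : A].
have points_lines c : c \in points -> c \notin lines.
  case/imsetP=> a _ ->; apply/imsetP => -[[x y]]; rewrite inE /= => nxy eqc.
  by have := card_cell nxy; rewrite -eqc cards1.
rewrite card_STS_annihilated (bigID (mem points)) /=; congr (_ * _).
  rewrite (eq_bigr (fun=> N1 w)) => [|_ /imsetP [a _ ->]]; last exact: card_piece_point.
  by rewrite prod_nat_const card_imset //; apply: set1_inj.
rewrite (bigID (mem lines)) /= [X in _ * X]big1 ?muln1; last first.
  move=> c /andP [npc nlc]; apply: card_piece_empty => // a.
  by apply: contraNneq npc => ->; apply: imset_f.
rewrite -card_lines mulKn // -prod_nat_const; apply: eq_big => [c | c /andP [_ /imsetP [[a b]]]].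
  by rewrite andbC; case: (boolP (c \in lines)) => //= lc; apply: contraTN lc => /points_lines.
by rewrite inE /= => nab ->; apply: card_piece_line.
Qed.

End Pieces.

(** * Refining f by one more coordinate *)

Lemma annihilates_block (V : finType) (A : zmodType) (f : V -> A) B x y z :
  annihilates f B -> x != y -> z != x -> z != y -> [set x; y; z] \in B ->
  f z = (- (f x + f y))%R.
Proof.
move=> /forall_inP fB nxy nzx nzy /fB; rewrite /zero_sum big_set3 // addrC addr_eq0.
by move/eqP.
Qed.

(** Fix x with value -(b + c). Sending y to the third point of the block through x and y maps the
    fibre over b injectively into the fibre over c, so all fibres have equal size. *)
Lemma balanced_of_annihilates (V : finType) (A : finZmodType) (f : V -> A) B w :
  (forall a : A, (a *+ 3 = 0)%R) -> is_STS B -> annihilates f B ->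
  (forall a, exists x, f x = a) -> #|V| = #|A| * w -> balanced f w.
Proof.
move=> A3 stsB fB f_surj cardV; pose fib a := [set x | f x == a].
have fib_le b c : #|fib b| <= #|fib c|.
  case: (eqVneq b c) => [-> // | nbc].
  have [x fx] := f_surj (- (b + c))%R.
  (* The default is never taken on [fib b], since every y there differs from x. *)
  pose t y := odflt y [pick z | [&& z != x, z != y & [set x; y; z] \in B]].
  have neq_x y : y \in fib b -> x != y.
    rewrite inE => /eqP fy; apply: contra_neq (third_neq A3 nbc) => eqxy.
    by rewrite -fx eqxy fy.
  have tP y : y \in fib b -> [&& t y != x, t y != y & [set x; y; t y] \in B].
    move=> yb; rewrite /t; case: pickP => // nz.
    have [z [zx zy zB]] := exists_block stsB (neq_x y yb).
    by have := nz z; rewrite zx zy zB.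
  have t_inj : {in fib b &, injective t}.
    move=> y y' yb y'b eqt; have /and3P [tx ty tB] := tP y yb.
    have /and3P [t'x t'y t'B] := tP y' y'b.
    (* Both blocks contain x and the common third point, so they coincide. *)
    have eqb : [set x; y; t y] = [set x; y'; t y'].
      apply: (@through_inj _ B x (t y)) => //; rewrite ?inE ?eqxx ?orbT //.
        by rewrite eq_sym.
      by rewrite eqt eqxx orbT.
    have: y \in [set x; y'; t y'] by rewrite -eqb !inE eqxx orbT.
    rewrite !inE -eqt [y == t y]eq_sym (negPf ty) orbF eq_sym (negPf (neq_x y yb)).
    by move/eqP.
  rewrite -(card_in_imset t_inj); apply/subset_leq_card/subsetP => _ /imsetP [y yb ->].
  have /and3P [tx ty tB] := tP y yb.
  rewrite inE (annihilates_block fB (neq_x y yb) tx ty tB) fx.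
  by move: yb; rewrite inE => /eqP ->; rewrite opprD opprK addrAC addrN add0r.
have fibE a : #|fib a| = #|fib 0%R| by apply/eqP; rewrite eqn_leq !fib_le.
have bal0 : balanced f #|fib 0%R| by apply/forallP => a; rewrite -/(fib a) fibE.
suff -> : w = #|fib 0%R| by [].
have A_gt0 : 0 < #|A| by apply/card_gt0P; exists 0%R.
by apply/eqP; rewrite -(eqn_pmul2l A_gt0) -cardV (balanced_card bal0).
Qed.

Definition pair_fun (V A : Type) (f : V -> A) (h : V -> 'F_3) x : A * 'F_3 := (f x, h x).

Lemma annihilates_pair (V : finType) (A : finZmodType) (f : V -> A) (h : V -> 'F_3) B :
  annihilates (pair_fun f h) B = annihilates f B && annihilates h B.
Proof.
have zero_sum_pair b : zero_sum (pair_fun f h) b = zero_sum f b && zero_sum h b.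
  rewrite /zero_sum; suff -> : (\sum_(x in b) pair_fun f h x =
    (\sum_(x in b) f x, \sum_(x in b) h x))%R by rewrite xpair_eqE.
  by elim/big_rec3: _ => // x a c d _ ->.
apply/forall_inP/andP => [fhB | [/forall_inP fB /forall_inP hB] b bB]; last first.
  by rewrite zero_sum_pair fB ?hB.
by split; apply/forall_inP => b /fhB; rewrite zero_sum_pair => /andP [].
Qed.

Lemma F3_mul3 (a : 'F_3) : (a *+ 3 = 0)%R.
Proof. by rewrite -mulr_natr (_ : 3%:R = 0)%R ?mulr0 //; apply/eqP. Qed.

Lemma F3_third (a b c : 'F_3) : a != b -> [|| c == a, c == b | c == - (a + b)]%R.
Proof.
by move: a b c => [[|[|[|//]]] ia] [[|[|[|//]]] ib] [[|[|[|//]]] ic].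
Qed.

Lemma third_values (V : finType) (A C : zmodType) (f : V -> A) (h : V -> C) B x y :
  (forall a : A, (a *+ 3 = 0)%R) -> (forall c : C, (c *+ 3 = 0)%R) ->
  is_STS B -> annihilates f B -> annihilates h B ->
  exists z, f z = (- (f x + f y))%R /\ h z = (- (h x + h y))%R.
Proof.
move=> A3 C3 stsB fB hB.
case: (eqVneq x y) => [<- | nxy]; first by exists x; rewrite !opp_double.
have [z [nzx nzy xyzB]] := exists_block stsB nxy; exists z.
by rewrite (annihilates_block fB nxy nzx nzy) ?(annihilates_block hB nxy nzx nzy).
Qed.

(** Two values of [h] on one fibre yield the remaining value there through a third point, so [h] is
    onto on that fibre. Third points then carry this to every other fibre. *)
Lemma pair_fun_surj (V : finType) (A : finZmodType) (f : V -> A) (h : V -> 'F_3) B :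
  (forall a : A, (a *+ 3 = 0)%R) -> is_STS B -> annihilates f B -> annihilates h B ->
  (forall a, exists x, f x = a) -> (exists x y, f x = f y /\ h x != h y) ->
  forall p, exists x, pair_fun f h x = p.
Proof.
move=> A3 stsB fB hB f_surj [x0 [y0 [eq_f neq_h]]].
have third x y := third_values x y A3 F3_mul3 stsB fB hB.
have opp_third (C : zmodType) (c d : C) : (- (- (c + d) + d) = c)%R.
  by rewrite opprD opprK addrK.
have hit0 c : exists x, f x = f x0 /\ h x = c.
  have /or3P [] := F3_third c neq_h => /eqP ->.
  - by exists x0.
  - by exists y0.
  - by have [z [fz hz]] := third x0 y0; exists z; rewrite fz -eq_f opp_double.
(* The values at x and y are chosen so that their third point has exactly the values (a, c). *)
move=> [a c]; have [y fy] := f_surj (- (a + f x0))%R.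
have [x [fx hx]] := hit0 (- (c + h y))%R; have [z [fz hz]] := third x y.
by exists z; rewrite /pair_fun fz hz hx fx fy addrC !opp_third.
Qed.

(* The permutations preserving f act on the balanced refinements h, transitively and
   with stabilisers of order w'!^(3 |A|). *)
Lemma card_refinements (V A : finType) (f : V -> A) w w' : balanced f w ->
  #|[set h : {ffun V -> 'F_3} | balanced (pair_fun f h) w']| * w'`! ^ (#|A| * 3)
    <= w`! ^ #|A|.
Proof.
move=> f_bal; set H := [set h : {ffun V -> 'F_3} | _].
have [-> | [h0 h0H]] := set_0Vmem H; first by rewrite cards0.
have h0_bal : balanced (pair_fun f h0) w' by move: h0H; rewrite inE.
pose stab := [set s : {perm V} | [forall x, pair_fun f h0 (s x) == pair_fun f h0 x]].
have -> : w'`! ^ (#|A| * 3) = #|stab|.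
  by rewrite (card_fibre_perms h0_bal) card_prod card_Fp.
rewrite -(card_fibre_perms f_bal) -cardsX.
pose to_h0 (h : {ffun V -> 'F_3}) : {perm V} :=
  odflt 1%g [pick s : {perm V} | [forall x, pair_fun f h0 (s x) == pair_fun f h x]].
have to_h0P h x : h \in H -> pair_fun f h0 (to_h0 h x) = pair_fun f h x.
  rewrite inE => h_bal; rewrite /to_h0; case: pickP => [s /forallP/(_ x)/eqP // | no_s].
  have [s sP] := balanced_conj h_bal h0_bal.
  by case/negP: (no_s s); apply/forallP => u; rewrite sP.
(* [F (h, s)] pulls the reference pair with [h0] back to the pair with [h]. Hence it determines [h],
   and then [s] by cancellation. *)
pose F (p : {ffun V -> 'F_3} * {perm V}) := (to_h0 p.1 * p.2)%g.
have FP h s x : h \in H -> s \in stab -> pair_fun f h0 (F (h, s) x) = pair_fun f h x.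
  by move=> hH; rewrite inE permM /= => /forallP/(_ (to_h0 h x))/eqP ->; rewrite to_h0P.
have F_inj : {in setX H stab &, injective F}.
  move=> [h s] [k u]; rewrite !in_setX => /andP [hH sS] /andP [kH uS] eqF.
  have eqhk : h = k.
    by apply/ffunP => x; have [] : pair_fun f h x = pair_fun f k x by rewrite -(FP h s) // eqF FP.
  by move: eqF; rewrite /F eqhk /= => /mulgI ->.
rewrite -(card_in_imset F_inj); apply/subset_leq_card/subsetP => _ /imsetP [[h s] + ->].
rewrite in_setX inE => /andP [hH sS]; apply/forallP => x.
by have [-> _] := FP h s x hH sS.
Qed.

(** * The 3-rank and orthogonal functions *)

Lemma rV_mul3 m (a : 'rV['F_3]_m) : (a *+ 3 = 0)%R.
Proof. by apply/rowP => j; rewrite mulmxnE F3_mul3 mxE. Qed.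

Section Rank.

Local Open Scope ring_scope.

Variables (v m : nat) (f : 'I_v -> 'rV['F_3]_m) (B : {set {set 'I_v}}).
Hypothesis f_surj : forall a, exists x, f x = a.
Hypothesis stsB : is_STS B.
Hypothesis fB : annihilates f B.

Let incidence := \matrix_(i < #|B|, j < v) ((j \in enum_val i)%:R : 'F_3).
(** The columns are the constant 1 and the coordinates of [f]. Their span consists of the affine
    functions of [f]. *)
Let affine_mx := \matrix_(x < v) row_mx (1 : 'rV_1) (f x).

Lemma incidence_mulE k (h : 'I_v -> 'rV['F_3]_k) i :
  row i (incidence *m \matrix_x h x) = \sum_(x in enum_val i) h x.
Proof.
apply/rowP => j; rewrite !mxE summxE [RHS]big_mkcond /=.
by apply: eq_bigr => x _; rewrite !mxE; case: ifP => _; rewrite ?mul1r ?mul0r.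
Qed.

Lemma annihilatesE k (h : 'I_v -> 'rV['F_3]_k) :
  annihilates h B = (incidence *m \matrix_x h x == 0).
Proof.
apply/forall_inP/eqP => [hB | h0 b bB].
  by apply/row_matrixP => i; rewrite incidence_mulE row0; apply/eqP/hB/enum_valP.
apply/eqP; have := incidence_mulE h (enum_rank_in bB b).
by rewrite h0 row0 enum_rankK_in.
Qed.

(** The constant column is orthogonal to every block because blocks have three points and 3 = 0. *)
Lemma incidence_affine : incidence *m affine_mx = 0.
Proof.
apply/eqP; rewrite -annihilatesE; have [B3 _] := is_STSP _ stsB.
apply/forall_inP => b bB; apply/eqP.
rewrite (_ : \sum_(x in b) _ = row_mx (\sum_(x in b) 1) (\sum_(x in b) f x)); last first.
  by elim/big_rec3: _ => [|x a c d _ ->]; rewrite ?row_mx0 // add_row_mx.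
by rewrite (eqP (forall_inP fB b bB)) sumr_const B3 // rV_mul3 row_mx0.
Qed.

Lemma affine_mx_mul k (D : 'M['F_3]_(1 + m, k)) x :
  row x (affine_mx *m D) = f x *m dsubmx D + usubmx D.
Proof.
by rewrite row_mul rowK -{1}(vsubmxK D) mul_row_col mul1mx addrC.
Qed.

(** A linear relation between the columns is an affine function vanishing on the image of [f], which
    is the whole space. Evaluating at 0 and at the unit vectors kills all coefficients. *)
Lemma affine_mx_free : row_free affine_mx^T.
Proof.
apply: inj_row_free => u /(congr1 trmx); rewrite trmx_mul trmxK trmx0 => u0.
have u0x a : a *m dsubmx u^T + usubmx u^T = 0.
  by have [x <-] := f_surj a; rewrite -affine_mx_mul u0 row0.
have uu : usubmx u^T = 0 by have := u0x 0; rewrite mul0mx add0r.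
have ud : dsubmx u^T = 0.
  by apply/row_matrixP => i; have := u0x (delta_mx 0 i); rewrite uu addr0 row0 rowE.
by apply: trmx_inj; rewrite -[u^T]vsubmxK uu ud col_mx0 trmx0.
Qed.

Lemma affine_sub_ker : (affine_mx^T <= kermx incidence^T)%MS.
Proof. by apply/sub_kermxP; rewrite -trmx_mul incidence_affine trmx0. Qed.

(** The affine functions of [f] always lie in the kernel and span dimension 1 + m. The reverse
    inclusion thus amounts to the kernel having that same dimension. *)
Lemma affine_eq_ker :
  (kermx incidence^T <= affine_mx^T)%MS = (rank3 B == v - m - 1)%N.
Proof.
have rkA : \rank affine_mx^T = (1 + m)%N by apply/eqP; apply: affine_mx_free.
have [+ le_mv] : \rank (kermx incidence^T) = (v - rank3 B)%N /\ (1 + m <= v)%N.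
  by rewrite mxrank_ker mxrank_tr -rkA rank_leq_col.
have le_rk : (rank3 B <= v)%N by apply: rank_leq_col.
have [le_rank <-] := mxrank_leqif_sup affine_sub_ker; rewrite rkA => rkK.
move: le_rank; rewrite rkA rkK => le_rank.
by rewrite -subnDA [(m + 1)%N]addnC; apply/eqP/eqP => e; [rewrite e subKn | rewrite e subKn].
Qed.

Lemma affine_of_exact_rank k (h : 'I_v -> 'rV['F_3]_k) :
  rank3 B = (v - m - 1)%N -> annihilates h B ->
  exists (U : 'M_(m, k)) (c : 'rV_k), forall x, h x = f x *m U + c.
Proof.
move/eqP; rewrite -affine_eq_ker annihilatesE => ker_le /eqP hB.
have /submxP [D defD] : ((\matrix_x h x)^T <= affine_mx^T)%MS.
  by apply: submx_trans ker_le; apply/sub_kermxP; rewrite -trmx_mul hB trmx0.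
exists (dsubmx D^T), (usubmx D^T) => x.
by rewrite -affine_mx_mul -[affine_mx]trmxK -trmx_mul -defD trmxK rowK.
Qed.

(* Setting b = 0 and using 3 = 0, the third-point identity makes u - u 0 additive. *)
Lemma affine_of_third (u : 'rV['F_3]_m -> 'F_3) :
  (forall a b, u (- (a + b)) = - (u a + u b)) ->
  exists (U : 'M_(m, 1)) (c : 'rV_1), forall a, (u a)%:M = a *m U + c.
Proof.
move=> u3; pose w a := u a - u 0.
have w0 : w 0 = 0 by rewrite /w subrr.
have u0 : - (u 0 + u 0) = u 0 by rewrite opp_double ?F3_mul3.
have wN a : w (- a) = - w a.
  by have := u3 a 0; rewrite /w addr0 => ->; rewrite opprD -addrA -opprD u0 opprB addrC.
have wD a b : w (a + b) = w a + w b.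
  rewrite -[LHS]opprK -wN /w u3 [RHS]addrACA -(opprD (u 0)) u0.
  by rewrite opprB opprK addrC.
(* Every scalar of GF(3) is a natural multiple of 1, so additivity already gives linearity. *)
have wZ k a : w (k *: a) = k * w a.
  rewrite -{1}(natr_Zp k) -{2}(natr_Zp k) scaler_nat mulr_natl.
  by elim: {k}(k : nat) => [|k IHk]; rewrite ?mulr0n // !mulrS wD IHk.
exists (\col_i w (delta_mx 0 i)), (u 0)%:M => a.
rewrite -[u a](subrK (u 0)) raddfD -/(w a) /=; congr (_ + _).
apply/rowP => j; rewrite !ord1 !mxE eqxx mulr1n {1}[a]row_sum_delta.
rewrite (big_morph w wD w0); apply: eq_bigr => i _.
by rewrite wZ !mxE.
Qed.

(** If the rank is not exact, some kernel vector is not an affine function of [f]. Were it to factor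
    through [f], the factor would satisfy the third-point identity and so be affine. *)
Lemma exists_nonfactoring :
  rank3 B != (v - m - 1)%N ->
  exists2 h : 'I_v -> 'F_3, annihilates h B & exists x y, f x = f y /\ h x != h y.
Proof.
rewrite -affine_eq_ker => /row_subPn [i not_affine].
pose h x := kermx incidence^T i x.
have hE : (\matrix_x (h x)%:M : 'cV_v)^T = row i (kermx incidence^T).
  by apply/rowP => x; do 3!rewrite [LHS]mxE; rewrite [RHS]mxE eqxx.
have hB1 : annihilates (fun x => (h x)%:M : 'rV_1) B.
  rewrite annihilatesE -trmx_eq0 trmx_mul hE.
  by apply/eqP; apply/sub_kermxP; apply: row_sub.
have hB : annihilates h B.
  apply/forall_inP => b bB; apply/eqP; have /eqP/rowP/(_ 0) := forall_inP hB1 b bB.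
  by rewrite summxE mxE => {2}<-; apply: eq_bigr => x _; rewrite mxE eqxx.
exists h => //.
have [/existsP [x /existsP [y /andP [/eqP fxy hxy]]] | factors] :=
  boolP [exists x, exists y, (f x == f y) && (h x != h y)]; first by exists x, y.
case/negP: not_affine.
have {}factors x y : f x = f y -> h x = h y.
  move=> fxy; apply/eqP; apply: contraNT factors => hxy.
  by apply/existsP; exists x; apply/existsP; exists y; rewrite fxy eqxx.
(* A section of [f] turns the factored function into one defined on the vector space itself. *)
have [g gK] : exists g, forall a, f (g a) = a.
  by have [g] := fin_all_exists f_surj; exists g.
have [a b | U [c Uc]] := @affine_of_third (h \o g).
  have [z [fz hz]] := third_values (g a) (g b) (@rV_mul3 m) F3_mul3 stsB fB hB.
  by rewrite /= -hz; apply: factors; rewrite fz !gK.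
rewrite -hE; apply/submxP; exists (col_mx c U)^T.
rewrite -trmx_mul; congr (_^T); apply/row_matrixP => x.
rewrite affine_mx_mul col_mxKd col_mxKu -Uc rowK /=.
by congr (_%:M); apply: factors; rewrite gK.
Qed.

End Rank.

(** * Counting isomorphism classes *)

Lemma exists_balanced (V A : finType) w :
  #|V| = #|A| * w -> exists f : V -> A, balanced f w.
Proof.
move=> cardV; have e : #|V| = #|{: A * 'I_w}| by rewrite card_prod card_ord.
pose psi x : A * 'I_w := enum_val (cast_ord e (enum_rank x)).
have psi_bij : bijective psi.
  apply: inj_card_bij; last by rewrite e.
  by move=> x y /enum_val_inj /cast_ord_inj /enum_rank_inj.
exists (fst \o psi); apply/forallP => a.
rewrite (_ : [set x | _] = psi @^-1: setX [set a] setT); last first.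
  by apply/setP => x; rewrite !inE andbT.
by rewrite on_card_preimset ?cardsX ?cards1 ?cardsT ?card_ord ?mul1n //; apply: onW_bij.
Qed.

Lemma balanced_surj (V A : finType) (f : V -> A) w :
  0 < w -> balanced f w -> forall a, exists x, f x = a.
Proof.
move=> w_gt0 /forallP bal a; have : 0 < #|[set x | f x == a]| by rewrite (eqP (bal a)).
by case/card_gt0P => x; rewrite inE => /eqP; exists x.
Qed.

(** Each permutation [al] of [A] lifts to [V], since [al \o f] is again balanced. A similarity
    inducing [al] differs from the chosen lift by a permutation preserving [f]. *)
Lemma card_similarities (V A : finType) (f : V -> A) w (G : {set {perm A}}) :
  balanced f w ->
  #|[set s : {perm V} | [exists al in G, forall x, f (s x) == al (f x)]]| <= w`! ^ #|A| * #|G|.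
Proof.
move=> f_bal; set S := [set s | _]; rewrite -(card_fibre_perms f_bal).
set stab := [set s | _].
have lift_ex (al : {perm A}) : exists s : {perm V}, [forall x, f (s x) == al (f x)].
  have al_bal : balanced (al \o f) w.
    apply/forallP => a; rewrite -(eqP (forallP f_bal (al^-1 a)%g)).
    apply/eqP; apply: eq_card => x; rewrite !inE /=.
    by rewrite -(inj_eq (@perm_inj _ al) (f x)) permKV.
  by have [s sP] := balanced_conj al_bal f_bal; exists s; apply/forallP => x; rewrite sP.
have [lift liftP] := fin_all_exists lift_ex.
rewrite -cardsX; apply: leq_trans (leq_imset_card (fun p => p.1 * lift p.2)%g _).
apply/subset_leq_card/subsetP => s; rewrite inE => /exists_inP [al alG /forallP sP].
apply/imsetP; exists ((s * (lift al)^-1)%g, al); last by rewrite /= mulgKV.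
rewrite in_setX alG andbT inE; apply/forallP => x; rewrite permM; apply/eqP.
apply: (@perm_inj _ al); rewrite -(eqP (sP x)).
by rewrite -(eqP (forallP (liftP al) _)) permKV.
Qed.

Lemma annihilates_lift (V : finType) (A : zmodType) (f : V -> A) (s : {perm V}) B :
  annihilates f (lift_system s B) = annihilates (f \o s) B.
Proof.
have zero_sum_lift (b : {set V}) : zero_sum f (s @: b) = zero_sum (f \o s) b.
  by rewrite /zero_sum big_imset //=; apply: in2W perm_inj.
apply/forall_inP/forall_inP => [fB b bB | fB _ /imsetP [b bB ->]].
  by rewrite -zero_sum_lift fB // imset_f.
by rewrite zero_sum_lift fB.
Qed.

(** The function [f \o s] annihilates [B], so exactness of the rank makes it an affine function of
    [f]. Surjectivity of [f] makes the linear part invertible. *)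
Lemma similarity_of_exact_rank v m (f : 'I_v -> 'rV['F_3]_m) B (s : {perm 'I_v}) :
  (forall a, exists x, f x = a) -> is_STS B -> annihilates f B ->
  rank3 B = v - m - 1 -> annihilates f (lift_system s B) ->
  exists2 al, al \in AGL3 m & forall x, f (s x) = al (f x).
Proof.
move=> f_surj stsB fB rkB; rewrite annihilates_lift => fsB.
have [U [c Uc]] := affine_of_exact_rank f_surj stsB fB rkB fsB.
have U_unit : U \in unitmx.
  rewrite -row_full_unit -sub1mx; apply/row_subP => i; apply/submxP.
  (* The point x has value e_i + c, so the value of [f] at the preimage of x under [s] is sent by
     [U] to the unit vector e_i. *)
  have [x fx] := f_surj (row i 1%:M + c)%R; have := Uc ((s^-1)%g x).
  by rewrite /= permKV fx => /addIr ->; exists (f ((s^-1)%g x)).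
have al_inj : injective (fun a : 'rV_m => a *m U + c)%R.
  by move=> a b /addIr /(congr1 (mulmx^~ (invmx U))); rewrite !mulmxK.
exists (perm al_inj) => [|x]; last by rewrite permE -Uc.
rewrite inE; apply/existsP; exists U; apply/existsP; exists c.
by rewrite U_unit; apply/forallP => a; rewrite permE.
Qed.

(** Each element of [G] is assigned to its class in [D]. A class that meets [G] receives at most [k]
    elements, any other class receives none. *)
Lemma card_le_classes (T : finType) (R : rel T) (D G : {set T}) k :
  equivalence_rel R -> G \subset D ->
  (forall x, x \in G -> #|[set y in G | R x y]| <= k) ->
  #|G| <= #|equivalence_partition R D| * k.
Proof.
move=> eqR /subsetP GD Gk; pose cl x := [set y in D | R x y].
have clP x : x \in G -> cl x \in equivalence_partition R D.
  by move=> xG; apply: imset_f (GD x xG).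
rewrite -sum1_card (partition_big _ _ clP) /= -sum_nat_const.
apply: leq_sum => C _; rewrite sum1dep_card.
have [-> | [x]] := set_0Vmem [set x in G | cl x == C]; first by rewrite cards0.
rewrite inE => /andP [xG /eqP clx]; apply: leq_trans (Gk x xG).
apply/subset_leq_card/subsetP => y; rewrite !inE => /andP [yG /eqP cly].
have: y \in cl x by rewrite clx -cly inE GD //; have [->] := eqR y y y.
by rewrite inE yG => /andP [].
Qed.

Lemma leq_card_bigcup (I T : finType) (H : {set I}) (F : I -> {set T}) :
  #|\bigcup_(i in H) F i| <= \sum_(i in H) #|F i|.
Proof.
elim/big_rec2: _ => [|i S k _ IH]; first by rewrite cards0.
by rewrite (leq_trans (leq_card_setU _ _).1) // leq_add2l.
Qed.

Definition exact_systems v m (f : 'I_v -> 'rV['F_3]_m) : {set {set {set 'I_v}}} :=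
  [set B | [&& is_STS B, annihilates f B & rank3 B == v - m - 1]].

Lemma card_iso_exact v m (f : 'I_v -> 'rV['F_3]_m) w B :
  0 < w -> balanced f w -> B \in exact_systems f ->
  #|[set B' in exact_systems f | iso_STS B B']| <= w`! ^ #|'rV['F_3]_m| * #|AGL3 m|.
Proof.
move=> w_gt0 f_bal; rewrite inE => /and3P [stsB fB /eqP rkB].
apply: leq_trans (card_similarities (AGL3 m) f_bal).
apply: leq_trans (leq_imset_card (fun s : {perm _} => lift_system s B) _).
apply/subset_leq_card/subsetP => B'; rewrite !inE => /andP [/and3P [_ fB' _]].
case/existsP=> s /eqP defB'; apply/imsetP; exists s => //.
rewrite defB' in fB'.
have [al alG fs] := similarity_of_exact_rank (balanced_surj w_gt0 f_bal) stsB fB rkB fB'.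
by rewrite inE; apply/exists_inP; exists al => //; apply/forallP => x; rewrite fs.
Qed.

(** A system whose rank is not exact is annihilated by a pair [(f, h)] with [h] a balanced
    refinement. The second term is the union bound over all such [h]. *)
Lemma card_annihilated_le v m (f : 'I_v -> 'rV['F_3]_m) w w' q :
  0 < w -> balanced f w -> w = 3 * w' -> #|'rV['F_3]_m| * 3 = q ->
  #|[set B : {set {set 'I_v}} | is_STS B && annihilates f B]| <=
  #|exact_systems f| + #|[set h : {ffun 'I_v -> 'F_3} | balanced (pair_fun f h) w']|
     * (N1 w' ^ q * N3 w' ^ (q * (q - 1) %/ 6)).
Proof.
move=> w_gt0 f_bal defw defq; set H := [set h : {ffun _ -> _} | _].
have f_surj := balanced_surj w_gt0 f_bal.
have card_pair : #|{: 'rV['F_3]_m * 'F_3}| = q by rewrite card_prod card_Fp.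
have A3 (p : 'rV['F_3]_m * 'F_3) : (p *+ 3 = 0)%R.
  by case: p => a c; apply: injective_projections; rewrite raddfMn /= ?rV_mul3 ?F3_mul3.
pose bad (h : {ffun 'I_v -> 'F_3}) :=
  [set B : {set {set 'I_v}} | is_STS B && annihilates (pair_fun f h) B].
have <- : \sum_(h in H) #|bad h| = #|H| * (N1 w' ^ q * N3 w' ^ (q * (q - 1) %/ 6)).
  rewrite -sum_nat_const; apply: eq_bigr => h; rewrite inE => h_bal.
  by rewrite (card_STS_annihilated_balanced A3 h_bal) card_pair.
apply: leq_trans (leq_add (leqnn _) (leq_card_bigcup H bad)).
apply: leq_trans (leq_card_setU _ _).1; apply/subset_leq_card/subsetP => B.
rewrite !inE => /andP [stsB fB]; rewrite stsB fB /=.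
case: (boolP (rank3 B == _)) => //= nrk.
have [h hB nonfactor] := exists_nonfactoring f_surj stsB fB nrk.
have eqh : finfun h =1 h by apply: ffunE.
have pair_eq : pair_fun f (finfun h) =1 pair_fun f h by move=> x; rewrite /pair_fun eqh.
have fhB : annihilates (pair_fun f (finfun h)) B.
  rewrite annihilates_pair fB; apply/forall_inP => b bB.
  by rewrite /zero_sum (eq_bigr h) //; apply: forall_inP hB b bB.
apply/bigcupP; exists (finfun h); last by rewrite inE stsB.
rewrite inE; apply: (balanced_of_annihilates A3 stsB fhB).
  move=> p; have [x <-] := pair_fun_surj (@rV_mul3 m) stsB fB hB f_surj nonfactor p.
  by exists x; rewrite pair_eq.
by rewrite (balanced_card f_bal) card_pair defw -defq mulnA.
Qed.

(** * From the counts to the inequality *)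

Local Open Scope ring_scope.

(** After division by [a * L], the error term h X' / (a L) is at most X' / b, because h / a is at
    most 1 / b and [L] is at least 1. *)
Lemma ratio_bound (X X' nr a L b h : nat) :
  (0 < a)%N -> (0 < L)%N -> (0 < b)%N ->
  (X <= nr * (a * L) + h * X')%N -> (h * b <= a)%N ->
  X%:R / (a * L)%N%:R - X'%:R / b%:R <= nr%:R :> rat.
Proof.
move=> a0 L0 b0 hX hb.
have gt0 : 0 < (a * L)%N%:R :> rat by rewrite ltr0n muln_gt0 a0.
rewrite lerBlDr ler_pdivrMr // mulrDl.
apply: (@le_trans _ _ (nr * (a * L) + h * X')%:R); first by rewrite ler_nat.
rewrite natrD !natrM lerD2l -!natrM mulrAC ler_pdivlMr ?ltr0n // -!natrM ler_nat.
by rewrite mulnC mulnA [(b * h)%N]mulnC [(X' * _)%N]mulnC leq_mul2r (leq_trans hb) ?orbT ?leq_pmulr.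
Qed.

Theorem theorem4p4 (n t : nat) (ht : (2 <= t)%N) (htn : (t <= n - 1)%N) :
  let T := (3 ^ t)%N in
  let T' := (3 ^ (t - 1))%N in
  let M := (3 ^ (n - t))%N in
  let M' := (3 ^ (n - t + 1))%N in
  ((N1 T)%:R ^+ M * (N3 T)%:R ^+ (M * (M - 1) %/ 6)%N)
      / ((T`!)%:R ^+ M * #|AGL3 (n - t)|%:R)
    - ((N1 T')%:R ^+ M' * (N3 T')%:R ^+ (M' * (M' - 1) %/ 6)%N)
      / ((T'`!)%:R ^+ (M' - (n - t) - 2)%N)
  <= (nr_eq n t)%:R :> rat.
Proof.
cbv zeta; set T := (3 ^ t)%N; set T' := (3 ^ (t - 1))%N.
set M := (3 ^ (n - t))%N; set M' := (3 ^ (n - t + 1))%N; set m := (n - t)%N.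
have cardA : #|'rV['F_3]_m| = M by rewrite card_mx mul1n card_Fp.
have defM' : M' = (M * 3)%N by rewrite /M' addn1 expnSr.
have defT : T = (3 * T')%N by rewrite /T -(@subnK 1 t) ?addn1 ?expnS //; lia.
have T_gt0 : (0 < T)%N by rewrite expn_gt0.
have [f f_bal] : exists f : 'I_(3 ^ n) -> 'rV['F_3]_m, balanced f T.
  by apply: exists_balanced; rewrite card_ord cardA -expnD subnK //; lia.
have f_surj := balanced_surj T_gt0 f_bal.
pose H := [set h : {ffun 'I_(3 ^ n) -> 'F_3} | balanced (pair_fun f h) T'].
rewrite -!natrX -!natrM; apply: (@ratio_bound _ _ _ _ _ _ #|H|).
- by rewrite expn_gt0 fact_gt0.
- apply/card_gt0P; exists 1%g; rewrite inE; apply/existsP; exists 1%:M.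
  by apply/existsP; exists 0; rewrite unitmx1; apply/forallP => x; rewrite perm1 mulmx1 addr0.
- by rewrite expn_gt0 fact_gt0.
- have := card_annihilated_le T_gt0 f_bal defT (erefl _).
  rewrite (card_STS_annihilated_balanced (@rV_mul3 m) f_bal) cardA -defM' => /leq_trans; apply.
  rewrite leq_add2r -cardA; apply: (@card_le_classes _ _ _ (exact_systems f)).
  + exact: iso_STS_equiv.
  (* Since n < 3 ^ n, no subtraction truncates, and 3 ^ n - (n - t) - 1 equals 3 ^ n - n - 1 + t. *)
  + apply/subsetP => B; rewrite !inE => /and3P [-> _ /eqP ->].
    apply/eqP; rewrite /m; have := ltn_expl n (isT : 1 < 3)%N; lia.
  + by move=> B; apply: card_iso_exact.
(* The refinements satisfy the bound with exponent [M']. Lowering the exponent to [M' - (n - t) - 2]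
   only decreases the left side, as the factorial is at least 1. *)
have := card_refinements T' f_bal; rewrite cardA -defM'; apply: leq_trans.
by rewrite leq_mul2l leq_pexp2l ?orbT ?fact_gt0 //; lia.
Qed.
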